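(* Let $\mathcal C$ and $\mathcal C'$ be triangulated categories endowed with weight structures $w$ and $w'$, respectively; let $F:\mathcal C\to\mathcal C'$ be an exact functor that is essentially surjective on objects. (1) $F$ is weight-exact with respect to $(w,w')$ if and only if $\mathcal C'_{w'\le 0}=\mathrm{Kar}_{\mathcal C'}(F(\mathcal C_{w\le 0}))$ and $\mathcal C'_{w'\ge 0}=\mathrm{Kar}_{\mathcal C'}(F(\mathcal C_{w\ge 0}))$. (2) Moreover, if this is the case then $\mathcal C'_{[m,n]}=\mathrm{Kar}_{\mathcal C'}(F(\mathcal C_{[m,n]}))$ for any integers $m\le n$. (3) If $F$ is weight-exact and respects coproducts of less than $\alpha$ objects for an infinite regular cardinal $\alpha$ (resp., all small coproducts) and $w$ is $\alpha$-smashing (resp. smashing), then $w'$ also is. (4) Assume that $F$ is weight-exact; let $G:\mathcal C'\to\mathcal D$ be an exact functor, where $\mathcal D$ is a triangulated category endowed with a weight structure $v$, and assume that $G\circ F$ is weight-exact (with respect to $(w,v)$). Then $G$ is weight-exact (with respect to $(w',v)$) as well.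
   Context: A weight structure $w$ on a triangulated category $\mathcal C$ is a pair of classes $\mathcal C_{w\le 0},\mathcal C_{w\ge 0}\subset\mathrm{Obj}\,\mathcal C$ such that: (i) both are closed under $\mathcal C$-retracts; (ii) $\mathcal C_{w\le 0}\subset\mathcal C_{w\le 0}[1]$ and $\mathcal C_{w\ge 0}[1]\subset \mathcal C_{w\ge 0}$; (iii) $\mathcal C(X,Y)=0$ for all $X\in\mathcal C_{w\le 0}$, $Y\in\mathcal C_{w\ge 0}[1]$; (iv) every $M\in\mathrm{Obj}\,\mathcal C$ fits into a distinguished triangle $LM\to M\to RM\to LM[1]$ with $LM\in\mathcal C_{w\le 0}$, $RM\in\mathcal C_{w\ge 0}[1]$. $\mathcal C_{w\ge i}=\mathcal C_{w\ge 0}[i]$, $\mathcal C_{w\le i}=\mathcal C_{w\le 0}[i]$, and $\mathcal C_{[m,n]}=\mathcal C_{w\ge m}\cap\mathcal C_{w\le n}$ (similarly for $\mathcal C'$ with $w'$). An exact functor $F:(\mathcal C,w)\to(\mathcal C',w')$ is weight-exact if $F(\mathcal C_{w\le 0})\subset\mathcal C'_{w'\le 0}$ and $F(\mathcal C_{w\ge 0})\subset\mathcal C'_{w'\ge 0}$. For a class $X$ of objects of $\mathcal C'$, $\mathrm{Kar}_{\mathcal C'}(X)$ is the class of all $\mathcal C'$-retracts of elements of $X$ ($Y$ is a retract of $Z$ if $\mathrm{id}_Y$ factors through $Z$). $w$ is $\alpha$-smashing (resp. smashing) if $\mathcal C$ has coproducts of all families of fewer than $\alpha$ objects (resp. all small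 coproducts) and $\mathcal C_{w\ge 0}$ is closed under them. *)

(* Defs.v *)
From mathcomp Require Import all_boot all_order all_algebra.
From mathcomp Require Import boolp classical_sets functions cardinality.

Set Implicit Arguments.
Unset Strict Implicit.
Unset Printing Implicit Defensive.

Import GRing.Theory.
Local Open Scope classical_set_scope.
Local Open Scope card_scope.
Local Open Scope ring_scope.

(** * Preadditive categories and additive functors *)

(* Every abelian group is a [zmodType] classically, so taking [hom] in
   [zmodType] is no restriction. *)
Record preadditive := Preadditive {
  ob :> Type;
  hom : ob -> ob -> zmodType;
  idm : forall X, hom X X;
  comp : forall X Y Z, hom Y Z -> hom X Y -> hom X Z;
  compIm : forall X Y (f : hom X Y), comp (idm Y) f = f;
  compmI : forall X Y (f : hom X Y), comp f (idm X) = f;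
  compA : forall X Y Z T (h : hom Z T) (g : hom Y Z) (f : hom X Y),
    comp h (comp g f) = comp (comp h g) f;
  compDl : forall X Y Z (g1 g2 : hom Y Z) (f : hom X Y),
    comp (g1 + g2) f = comp g1 f + comp g2 f;
  compDr : forall X Y Z (g : hom Y Z) (f1 f2 : hom X Y),
    comp g (f1 + f2) = comp g f1 + comp g f2
}.

Arguments hom {_} _ _.
Arguments idm {_} _.
Arguments comp {_ _ _ _} _ _.

Declare Scope cat_scope.
Delimit Scope cat_scope with cat.
Local Open Scope cat_scope.
Notation "g ∘ f" := (comp g f) (at level 40, left associativity) : cat_scope.

Section Preadditive.
Variable C : preadditive.
Implicit Types X Y Z : C.

Definition is_iso X Y (f : hom X Y) :=
  exists2 g : hom Y X, g ∘ f = idm X & f ∘ g = idm Y.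

Definition isomorphic X Y := exists f : hom X Y, is_iso f.

Definition is_retract Y Z :=
  exists (i : hom Y Z) (p : hom Z Y), p ∘ i = idm Y.

Definition Kar (A : set C) : set C :=
  [set Y | exists2 Z, A Z & is_retract Y Z].

Definition is_zero Z := forall X,
  (forall f : hom Z X, f = 0) /\ (forall f : hom X Z, f = 0).

Definition is_biproduct X1 X2 Y (i1 : hom X1 Y) (i2 : hom X2 Y)
    (p1 : hom Y X1) (p2 : hom Y X2) :=
  [/\ p1 ∘ i1 = idm X1, p2 ∘ i2 = idm X2, p1 ∘ i2 = 0, p2 ∘ i1 = 0 &
      i1 ∘ p1 + i2 ∘ p2 = idm Y].

Definition is_coproduct (I : Type) (X : I -> C) Y (inj : forall i, hom (X i) Y) :=
  forall T (f : forall i, hom (X i) T),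
    exists! u : hom Y T, forall i, u ∘ inj i = f i.

End Preadditive.

Record additive_functor (C D : preadditive) := AdditiveFunctor {
  fob :> C -> D;
  fmap : forall X Y, hom X Y -> hom (fob X) (fob Y);
  fmapI : forall X, fmap (idm X) = idm (fob X);
  fmap_comp : forall X Y Z (g : hom Y Z) (f : hom X Y),
    fmap (g ∘ f) = fmap g ∘ fmap f;
  fmapD : forall X Y (f g : hom X Y), fmap (f + g) = fmap f + fmap g
}.

Arguments fmap {_ _} _ {_ _} _.

Definition functor_id (C : preadditive) : additive_functor C C.
Proof. by exists (fun X => X) (fun X Y f => f). Defined.

Definition functor_comp (C D E : preadditive)
  (G : additive_functor D E) (F : additive_functor C D) : additive_functor C E.
Proof.
exists (fun X => G (F X)) (fun X Y f => fmap G (fmap F f)).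
- by move=> X; rewrite !fmapI.
- by move=> X Y Z g f; rewrite !fmap_comp.
- by move=> X Y f g; rewrite !fmapD.
Defined.

Record nat_iso (C D : preadditive) (F G : additive_functor C D) := NatIso {
  nt :> forall X, hom (F X) (G X);
  nt_natural : forall X Y (f : hom X Y), nt Y ∘ fmap F f = fmap G f ∘ nt X;
  nt_is_iso : forall X, is_iso (nt X)
}.

Definition essentially_surjective (C D : preadditive) (F : additive_functor C D) :=
  forall Y : D, exists X : C, isomorphic (F X) Y.

(** * Triangulated categories *)

(* The shift is an additive autoequivalence with a chosen quasi-inverse; a
   shift that is an automorphism is the special case in which [shiftK] and
   [unshiftK] are identities.  [dist f g h] says that X -> Y -> Z -> X[1] is a
   distinguished triangle. *)
Record triangulated := Triangulated {
  tcat :> preadditive;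
  has_zero : exists Z : tcat, is_zero Z;
  has_biproducts : forall X1 X2 : tcat, exists (Y : tcat)
    (i1 : hom X1 Y) (i2 : hom X2 Y) (p1 : hom Y X1) (p2 : hom Y X2),
    is_biproduct i1 i2 p1 p2;
  shift : additive_functor tcat tcat;
  unshift : additive_functor tcat tcat;
  shiftK : nat_iso (functor_comp unshift shift) (functor_id tcat);
  unshiftK : nat_iso (functor_comp shift unshift) (functor_id tcat);
  dist : forall X Y Z : tcat, hom X Y -> hom Y Z -> hom Z (shift X) -> Prop;
  dist_iso : forall (X Y Z X' Y' Z' : tcat)
      (f : hom X Y) (g : hom Y Z) (h : hom Z (shift X))
      (f' : hom X' Y') (g' : hom Y' Z') (h' : hom Z' (shift X'))
      (a : hom X X') (b : hom Y Y') (c : hom Z Z'),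
    is_iso a -> is_iso b -> is_iso c ->
    b ∘ f = f' ∘ a -> c ∘ g = g' ∘ b -> fmap shift a ∘ h = h' ∘ c ->
    dist f g h -> dist f' g' h';
  dist_id : forall (X Z : tcat), is_zero Z ->
    dist (idm X) (0 : hom X Z) (0 : hom Z (shift X));
  dist_cone : forall (X Y : tcat) (f : hom X Y),
    exists (Z : tcat) (g : hom Y Z) (h : hom Z (shift X)), dist f g h;
  dist_rot : forall (X Y Z : tcat)
      (f : hom X Y) (g : hom Y Z) (h : hom Z (shift X)),
    dist f g h <-> dist g h (- fmap shift f);
  dist_morph : forall (X Y Z X' Y' Z' : tcat)
      (f : hom X Y) (g : hom Y Z) (h : hom Z (shift X))
      (f' : hom X' Y') (g' : hom Y' Z') (h' : hom Z' (shift X'))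
      (a : hom X X') (b : hom Y Y'),
    dist f g h -> dist f' g' h' -> b ∘ f = f' ∘ a ->
    exists2 c : hom Z Z', c ∘ g = g' ∘ b & fmap shift a ∘ h = h' ∘ c;
  dist_octa : forall (X Y Z X' Y' Z' : tcat) (f : hom X Y) (g : hom Y Z)
      (a : hom Y Z') (a' : hom Z' (shift X))
      (b : hom Z X') (b' : hom X' (shift Y))
      (c : hom Z Y') (c' : hom Y' (shift X)),
    dist f a a' -> dist g b b' -> dist (g ∘ f) c c' ->
    exists (u : hom Z' Y') (v : hom Y' X'),
      [/\ dist u v (fmap shift a ∘ b'),
          u ∘ a = c ∘ g, c' ∘ u = a',
          v ∘ c = b & b' ∘ v = fmap shift f ∘ c']
}.

Arguments shift {_}.
Arguments unshift {_}.
Arguments dist {_ _ _ _} _ _ _.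

Definition shiftn (C : triangulated) (n : int) (X : C) : C :=
  match n with
  | Posz k => iter k (@shift C) X
  | Negz k => iter k.+1 (@unshift C) X
  end.

(* A[n], closed under isomorphisms since [shift] is only an equivalence. *)
Definition shift_class (C : triangulated) (A : set C) (n : int) : set C :=
  [set Y | exists2 X, A X & isomorphic Y (shiftn n X)].

Record exact_functor (C D : triangulated) := ExactFunctor {
  efun :> additive_functor C D;
  eshift : nat_iso (functor_comp efun shift) (functor_comp shift efun);
  efun_dist : forall (X Y Z : C) (f : hom X Y) (g : hom Y Z) (h : hom Z (shift X)),
    dist f g h -> dist (fmap efun f) (fmap efun g) (eshift X ∘ fmap efun h)
}.

Lemma is_iso_comp (C : preadditive) (X Y Z : C) (g : hom Y Z) (f : hom X Y) :
  is_iso g -> is_iso f -> is_iso (g ∘ f).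
Proof.
move=> [g' g'g gg'] [f' f'f ff']; exists (f' ∘ g').
- by rewrite -compA (compA g') g'g compIm.
- by rewrite -compA (compA f) ff' compIm.
Qed.

Lemma is_iso_fmap (C D : preadditive) (F : additive_functor C D) (X Y : C)
  (f : hom X Y) : is_iso f -> is_iso (fmap F f).
Proof.
by move=> [g gf fg]; exists (fmap F g); rewrite -fmap_comp (gf, fg) fmapI.
Qed.

Definition exact_comp (C D E : triangulated)
  (G : exact_functor D E) (F : exact_functor C D) : exact_functor C E.
Proof.
unshelve refine {| efun := functor_comp G F; eshift := _ |}.
- exists (fun X => eshift G (F X) ∘ fmap G (eshift F X)).
  + move=> X Y f /=.
    rewrite -compA -fmap_comp (nt_natural (eshift F)) /= fmap_comp compA.
    by rewrite (nt_natural (eshift G)) /= -compA.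
  + move=> X; apply: is_iso_comp; first exact: (nt_is_iso (eshift G)).
    exact: (is_iso_fmap G (nt_is_iso (eshift F) X)).
- move=> X Y Z f g h /(efun_dist F)/(efun_dist G) /=.
  by rewrite fmap_comp compA.
Defined.

(** * Weight structures *)

Record weight_structure (C : triangulated) := WeightStructure {
  wle : set C;
  wge : set C;
  wle_retract : forall Y Z : C, is_retract Y Z -> wle Z -> wle Y;
  wge_retract : forall Y Z : C, is_retract Y Z -> wge Z -> wge Y;
  wle_shift : wle `<=` shift_class wle 1;
  wge_shift : shift_class wge 1 `<=` wge;
  weight_orth : forall X Y : C, wle X -> shift_class wge 1 Y ->
    forall f : hom X Y, f = 0;
  weight_decomp : forall M : C, exists (L R : C)
      (f : hom L M) (g : hom M R) (h : hom R (shift L)),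
    [/\ dist f g h, wle L & shift_class wge 1 R]
}.

Definition wrange (C : triangulated) (w : weight_structure C) (m n : int) : set C :=
  shift_class (wge w) m `&` shift_class (wle w) n.

Definition weight_exact (C D : triangulated)
    (w : weight_structure C) (v : weight_structure D) (F : exact_functor C D) :=
  F @` wle w `<=` wle v /\ F @` wge w `<=` wge v.

(** * Coproducts and smashing weight structures *)

(* A fixed universe of small types; all families are indexed by these. *)
Definition small := Type.

(* A cardinal is represented by a small type having that cardinality. *)
Definition card_lt (I A : small) :=
  [set: I] #<= [set: A] /\ ~ ([set: A] #<= [set: I]).

(* Regular: not a sum of fewer than |A| cardinals that are all less than |A|. *)
Definition infinite_regular (A : small) :=
  infinite_set [set: A] /\
  forall (I : small) (B : I -> small),
    card_lt I A -> (forall i, card_lt (B i) A) -> card_lt {i : I & B i} A.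

(* In the next three definitions, [K] selects the index types of the families
   under consideration. *)
Definition has_coproducts (C : preadditive) (K : small -> Prop) :=
  forall I : small, K I -> forall X : I -> C,
    exists (Y : C) (inj : forall i, hom (X i) Y), is_coproduct inj.

Definition closed_under_coproducts (C : preadditive) (K : small -> Prop) (A : set C) :=
  forall I : small, K I -> forall (X : I -> C) (Y : C) (inj : forall i, hom (X i) Y),
    is_coproduct inj -> (forall i, A (X i)) -> A Y.

Definition respects_coproducts (C D : preadditive) (K : small -> Prop)
    (F : additive_functor C D) :=
  forall I : small, K I -> forall (X : I -> C) (Y : C) (inj : forall i, hom (X i) Y),
    is_coproduct inj -> is_coproduct (fun i => fmap F (inj i)).

Definition fewer_than (A : small) : small -> Prop := fun I => card_lt I A.
Definition all_small : small -> Prop := fun=> True.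

Definition alpha_smashing (C : triangulated) (alpha : small) (w : weight_structure C) :=
  has_coproducts C (fewer_than alpha) /\
  closed_under_coproducts (fewer_than alpha) (wge w).

Definition smashing (C : triangulated) (w : weight_structure C) :=
  has_coproducts C all_small /\ closed_under_coproducts all_small (wge w).

(* Main.v *)
Require Import Defs.
From mathcomp Require Import all_boot all_order all_algebra.
From mathcomp Require Import boolp classical_sets functions cardinality.

Set Implicit Arguments.
Unset Strict Implicit.
Unset Printing Implicit Defensive.

(* Here [hom] must mean morphisms of a category, not the space of linear maps
   between vector spaces that bears the same name. *)
Import Defs.
Import GRing.Theory Num.Theory.
Local Open Scope classical_set_scope.
Local Open Scope ring_scope.
Local Open Scope cat_scope.

(** The whole statement rests on one observation.  Let F be weight-exact, N an
    object of C and L -> N -> R -> L[1] a weight decomposition of N, so that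
    F L -> F N -> F R -> F L[1] is a weight decomposition of F N.  If M is of
    weight >= 1 and a retract of F N, the projection F N -> M vanishes on F L
    by orthogonality, hence factors through F R, and M is a retract of F R
    ([retract_image_cone]).  Dually, a retract of F N that is of weight <= 0
    is a retract of F L ([retract_image_fiber]).

    Essential surjectivity makes every object of C' isomorphic to some F N.
    The dual form of the observation then gives C'_{w' <= 0} as the class of
    retracts of F (C_{w <= 0}) ([wle_Kar]); the first form, applied to M[1],
    does the same for C'_{w' >= 0} ([wge_Kar]).  The reverse inclusions hold
    because both classes of w' are closed under retracts, and weight-exactness
    follows from the two equalities because A lies in Kar A.

    For M in C'_{[m,n]}, a shift of M reduces to m = 1.  Then M is a retract of
    some F N with N of weight <= n, hence of F R.  Here R is of weight >= 1 by
    construction, and of weight <= n because it is an extension of L[1] by N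
    ([wle_cone], [wrange1_Kar]).

    For coproducts, families in C' lift to C up to isomorphism, which gives
    existence; a coproduct of objects of C'_{w' >= 0} is a retract of the image
    under F of a coproduct of objects of C_{w >= 0}, which gives closure.
    The last assertion is immediate since G preserves retracts.

    The shift is only an equivalence, so membership in A[n] is handled through
    [shift_classP]: when A is closed under retracts, Y lies in A[n] exactly
    when Y[-n] lies in A. *)

(** * Retracts, isomorphisms and coproducts in preadditive categories *)

Lemma dep_choice (I : Type) (T : I -> Type) (P : forall i, T i -> Prop) :
  (forall i, exists x, P i x) -> exists f : forall i, T i, forall i, P i (f i).
Proof. by move=> /(_ _)/cid PT; exists (fun i => projT1 (PT i)) => i; case: PT. Qed.

Section PreadditiveCalculus.
Variable C : preadditive.
Implicit Types X Y Z : C.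

Lemma comp0m X Y Z (f : hom X Y) : (0 : hom Y Z) ∘ f = 0.
Proof. by apply: (@addrI _ (0 ∘ f)); rewrite -compDl !addr0. Qed.

Lemma compm0 X Y Z (g : hom Y Z) : g ∘ (0 : hom X Y) = 0.
Proof. by apply: (@addrI _ (g ∘ 0)); rewrite -compDr !addr0. Qed.

Lemma compNm X Y Z (g : hom Y Z) (f : hom X Y) : (- g) ∘ f = - (g ∘ f).
Proof. by apply: (@addrI _ (g ∘ f)); rewrite -compDl !subrr comp0m. Qed.

Lemma compmN X Y Z (g : hom Y Z) (f : hom X Y) : g ∘ (- f) = - (g ∘ f).
Proof. by apply: (@addrI _ (g ∘ f)); rewrite -compDr !subrr compm0. Qed.

Lemma isomorphic_refl X : isomorphic X X.
Proof. by exists (idm X), (idm X); rewrite compIm. Qed.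

Lemma isomorphic_sym X Y : isomorphic X Y -> isomorphic Y X.
Proof. by move=> [f [g gf fg]]; exists g, f. Qed.

Lemma isomorphic_trans Y X Z :
  isomorphic X Y -> isomorphic Y Z -> isomorphic X Z.
Proof. by move=> [f If] [g Ig]; exists (g ∘ f); apply: is_iso_comp. Qed.

Lemma isomorphic_retract X Y : isomorphic X Y -> is_retract X Y.
Proof. by move=> [f [g gf fg]]; exists f, g. Qed.

Lemma retract_trans Y X Z :
  is_retract X Y -> is_retract Y Z -> is_retract X Z.
Proof.
move=> [i [p pi]] [j [q qj]]; exists (j ∘ i), (p ∘ q).
by rewrite -compA (compA q) qj compIm.
Qed.

Lemma sub_Kar (A : set C) : A `<=` Kar A.
Proof.
by move=> X AX; exists X => //; exact/isomorphic_retract/isomorphic_refl.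
Qed.

Definition hom_zero X Y := forall f : hom X Y, f = 0.

Lemma hom_zero_retract X Y X1 Y1 :
  is_retract X1 X -> is_retract Y1 Y -> hom_zero X Y -> hom_zero X1 Y1.
Proof.
move=> [i [p pi]] [j [q qj]] XY f.
have -> : f = q ∘ (j ∘ f ∘ p) ∘ i.
  by rewrite !compA qj compIm -compA pi compmI.
by rewrite (XY (j ∘ f ∘ p)) compm0 comp0m.
Qed.

(** Both structure maps are given by the universal properties, and their
    composite is the identity because it is so on every summand. *)
Lemma coproduct_retract (I : Type) (X Z : I -> C) (Y T : C)
    (a : forall i, hom (X i) Y) (b : forall i, hom (Z i) T) :
  is_coproduct a -> is_coproduct b ->
  (forall i, is_retract (X i) (Z i)) -> is_retract Y T.
Proof.
move=> aY bT /dep_choice[i /dep_choice[p pi]].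
have [u [ua _]] := aY _ (fun k => b k ∘ i k).
have [v [vb _]] := bT _ (fun k => a k ∘ p k).
exists u, v; have [x [_ xuniq]] := aY _ a.
transitivity x; [symmetry|]; apply: xuniq => k; last by rewrite compIm.
by rewrite -compA ua compA vb -compA pi compmI.
Qed.

Lemma is_coproduct_iso (I : Type) (X Z : I -> C) (Y : C)
    (a : forall i, hom (X i) Y) (f : forall i, hom (Z i) (X i)) :
  is_coproduct a -> (forall i, is_iso (f i)) ->
  is_coproduct (fun i => a i ∘ f i).
Proof.
move=> aY fI.
have /dep_choice[g gP] : forall i, exists g : hom (X i) (Z i),
    g ∘ f i = idm _ /\ f i ∘ g = idm _.
  by move=> i; have [g] := fI i; exists g.
move=> T t; have [u [ua uniq]] := aY T (fun i => t i ∘ g i).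
exists u; split=> [i|v va].
  by rewrite compA ua -compA (gP i).1 compmI.
by apply: uniq => i; rewrite -va -!compA (gP i).2 compmI.
Qed.

End PreadditiveCalculus.

(** * Additive functors *)

Section AdditiveFunctors.
Variables (C D : preadditive) (F : additive_functor C D).

Lemma fmap0 (X Y : C) : fmap F (0 : hom X Y) = 0.
Proof. by apply: (@addrI _ (fmap F 0)); rewrite -fmapD !addr0. Qed.

Lemma isomorphic_fmap (X Y : C) : isomorphic X Y -> isomorphic (F X) (F Y).
Proof. by move=> [f /(is_iso_fmap F)]; exists (fmap F f). Qed.

Lemma retract_fmap (X Y : C) : is_retract X Y -> is_retract (F X) (F Y).
Proof.
by move=> [i [p pi]]; exists (fmap F i), (fmap F p); rewrite -fmap_comp pi fmapI.
Qed.

Lemma nat_isoP (G : additive_functor C D) (e : nat_iso F G) (X : C) :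
  isomorphic (F X) (G X).
Proof. by exists (e X); exact: nt_is_iso. Qed.

(** Naturality of the isomorphism G F = id recovers f from G (F f). *)
Lemma faithful_of_retraction (G : additive_functor D C)
    (e : nat_iso (functor_comp G F) (functor_id C)) (X Y : C) (f g : hom X Y) :
  fmap F f = fmap F g -> f = g.
Proof.
move=> fg; have [d _ ed] := nt_is_iso e X.
have := nt_natural e f; rewrite /= fg (nt_natural e g) /= => E.
by rewrite -[f]compmI -[g]compmI -ed !compA E.
Qed.

End AdditiveFunctors.

(** * Iterated shifts *)

Section Shift.
Variable C : triangulated.
Implicit Types X Y Z T : C.

Lemma shift_faithful X Y (f g : hom X Y) :
  fmap shift f = fmap shift g -> f = g.
Proof. exact: (faithful_of_retraction (shiftK C)). Qed.

Lemma unshift_faithful X Y (f g : hom X Y) :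
  fmap unshift f = fmap unshift g -> f = g.
Proof. exact: (faithful_of_retraction (unshiftK C)). Qed.

(** The preimage of f is the conjugate of its desuspension by X[1][-1] = X and
    Y[1][-1] = Y.  That it maps to f is tested after [unshift], which is
    faithful. *)
Lemma shift_full X Y (f : hom (shift X) (shift Y)) :
  exists g : hom X Y, fmap shift g = f.
Proof.
have [d de ed] := nt_is_iso (shiftK C) X.
exists (shiftK C Y ∘ fmap unshift f ∘ d); apply: unshift_faithful.
have [d' de' _] := nt_is_iso (shiftK C) Y.
have /= E := nt_natural (shiftK C) (shiftK C Y ∘ fmap unshift f ∘ d).
have mono T (u v : hom T _) : shiftK C Y ∘ u = shiftK C Y ∘ v -> u = v.
  by move=> uv; rewrite -[u]compIm -[v]compIm -de' -!compA uv.
by apply: mono; rewrite E -compA de compmI.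
Qed.

Lemma isomorphic_shiftn n X Y :
  isomorphic X Y -> isomorphic (shiftn n X) (shiftn n Y).
Proof.
move=> XY; case: n => [k|k]; rewrite /shiftn; last move: k.+1 => {}k.
  by elim: k => //= k; exact: (isomorphic_fmap shift).
by elim: k => //= k; exact: (isomorphic_fmap unshift).
Qed.

Lemma retract_shiftn n X Y :
  is_retract X Y -> is_retract (shiftn n X) (shiftn n Y).
Proof.
move=> XY; case: n => [k|k]; rewrite /shiftn; last move: k.+1 => {}k.
  by elim: k => //= k; exact: (retract_fmap shift).
by elim: k => //= k; exact: (retract_fmap unshift).
Qed.

(** With [shiftnP] this gives the inductive steps for a shift exponent in int;
    the identity is strict for natural exponents and uses X[-1][1] = X for
    negative ones. *)
Lemma shiftnS n X : isomorphic (shiftn (n + 1) X) (shift (shiftn n X)).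
Proof.
case: n => [k|[|k]].
- by rewrite -PoszD addn1; exact: isomorphic_refl.
- exact/isomorphic_sym/(nat_isoP (unshiftK C)).
- have -> : Negz k.+1 + 1 = Negz k by rewrite !NegzE -addn1 PoszD opprD addrNK.
  exact/isomorphic_sym/(nat_isoP (unshiftK C)).
Qed.

Lemma shiftnP n X : isomorphic (shiftn (n - 1) X) (unshift (shiftn n X)).
Proof.
apply: isomorphic_trans (isomorphic_fmap unshift _); last first.
  by have := shiftnS (n - 1) X; rewrite subrK => /isomorphic_sym; exact.
exact/isomorphic_sym/(nat_isoP (shiftK C)).
Qed.

Lemma shiftnD m n X : isomorphic (shiftn (m + n) X) (shiftn m (shiftn n X)).
Proof.
elim/int_rec: m => [|k IH|k IH]; first by rewrite add0r; exact: isomorphic_refl.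
  rewrite -addn1 PoszD addrAC.
  apply: isomorphic_trans (shiftnS _ _) _.
  apply: isomorphic_trans (isomorphic_fmap shift IH) _.
  exact/isomorphic_sym/shiftnS.
rewrite -addn1 PoszD opprD addrAC.
apply: isomorphic_trans (shiftnP _ _) _.
apply: isomorphic_trans (isomorphic_fmap unshift IH) _.
exact/isomorphic_sym/shiftnP.
Qed.

Lemma shiftnDeq m n k X : m + n = k ->
  isomorphic (shiftn m (shiftn n X)) (shiftn k X).
Proof. by move=> <-; exact/isomorphic_sym/shiftnD. Qed.

Lemma shiftnK n X : isomorphic (shiftn (- n) (shiftn n X)) X.
Proof. exact: (shiftnDeq X (addNr n)). Qed.

Lemma shiftnVK n X : isomorphic (shiftn n (shiftn (- n) X)) X.
Proof. exact: (shiftnDeq X (addrN n)). Qed.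

Lemma hom_zero_shiftn n X Y :
  hom_zero (shiftn n X) (shiftn n Y) -> hom_zero X Y.
Proof.
case: n => [k|k]; rewrite /shiftn; last move: k.+1 => {}k.
  elim: k => //= k IH XY; apply: IH => f.
  by apply: shift_faithful; rewrite fmap0 [LHS]XY.
elim: k => //= k IH XY; apply: IH => f.
by apply: unshift_faithful; rewrite fmap0 [LHS]XY.
Qed.

Definition retract_closed (A : set C) := forall Y Z, is_retract Y Z -> A Z -> A Y.

(** Turns membership in a shifted class, stated up to isomorphism, into a
    condition on one specific object. *)
Lemma shift_classP (A : set C) n Y : retract_closed A ->
  shift_class A n Y <-> A (shiftn (- n) Y).
Proof.
move=> Acl; split=> [[X AX YX]|AY].
  apply: Acl AX; apply/isomorphic_retract.
  apply: isomorphic_trans (isomorphic_shiftn _ YX) _.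
  exact: shiftnK.
exists (shiftn (- n) Y) => //.
exact/isomorphic_sym/shiftnVK.
Qed.

Lemma shift_class_retract (A : set C) n :
  retract_closed A -> retract_closed (shift_class A n).
Proof.
move=> Acl Y Z YZ /(shift_classP _ _ Acl) AZ; apply/(shift_classP _ _ Acl).
exact: Acl (retract_shiftn _ YZ) AZ.
Qed.

Lemma shift_class_shiftn (A : set C) k m n Y : retract_closed A -> k + m = n ->
  shift_class A m Y -> shift_class A n (shiftn k Y).
Proof.
move=> Acl kmn /(shift_classP _ _ Acl) AY; apply/(shift_classP _ _ Acl).
apply: Acl AY; apply/isomorphic_retract/shiftnDeq.
by rewrite -kmn opprD addrAC addNr add0r.
Qed.

End Shift.

(** * Exactness of distinguished triangles *)

Section Triangles.
Variable C : triangulated.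
Variables (X Y Z : C) (f : hom X Y) (g : hom Y Z) (h : hom Z (shift X)).
Hypothesis fgh : dist f g h.

Lemma is_zero_shift (O : C) : is_zero O -> is_zero (shift O).
Proof.
move=> O0; have id0 : idm (shift O) = 0.
  by rewrite -fmapI (proj1 (O0 O) (idm O)) fmap0.
move=> T; split=> k; first by rewrite -[k]compmI id0 compm0.
by rewrite -[k]compIm id0 comp0m.
Qed.

(** Complete (0, p) to a morphism into the triangle 0 -> T -> T -> 0; its
    third component is the factorization. *)
Lemma triangle_weak_cokernel (T : C) (p : hom Y T) : p ∘ f = 0 ->
  exists q : hom Z T, q ∘ g = p.
Proof.
move=> pf; have [O O0] := has_zero C.
have idT : dist (0 : hom O T) (idm T) (0 : hom T (shift O)).
  by apply/dist_rot; rewrite fmap0 oppr0; exact/dist_id/is_zero_shift.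
have [|q qg _] := dist_morph (a := 0 : hom X O) (b := p) fgh idT.
  by rewrite pf compm0.
by exists q; rewrite qg compIm.
Qed.

(** The axiom on morphisms of triangles only completes the third component, so the
    triangles are rotated until the sought map T[1] -> X[1] sits there; it
    descends to T -> X since the shift is fully faithful. *)
Lemma triangle_weak_kernel (T : C) (p : hom T Y) : g ∘ p = 0 ->
  exists q : hom T X, f ∘ q = p.
Proof.
move=> gp; have [O O0] := has_zero C.
have idT : dist (0 : hom T O) (0 : hom O (shift T)) (- fmap shift (idm T)).
  by apply/(dist_rot (idm T) 0 0)/dist_id.
have ghf := proj1 (dist_rot f g h) fgh.
have [|c _ cE] := dist_morph (a := p) (b := 0 : hom O Z) idT ghf.
  by rewrite gp comp0m.
have [q qc] := shift_full c; exists q; apply: shift_faithful.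
rewrite fmap_comp qc; apply: oppr_inj.
by rewrite -compNm -cE fmapI compmN compmI.
Qed.

End Triangles.

(** * Classes of a weight structure *)

Section WeightStructures.
Variables (C : triangulated) (w : weight_structure C).
Implicit Types X Y L N R : C.

Let wleR : retract_closed (wle w). Proof. exact: wle_retract. Qed.
Let wgeR : retract_closed (wge w). Proof. exact: wge_retract. Qed.

(** In a weight decomposition of X the map X -> R vanishes, so the identity of
    X lifts to L. *)
Lemma wle_of_hom_zero X :
  (forall Y, shift_class (wge w) 1 Y -> hom_zero X Y) -> wle w X.
Proof.
move=> X0; have [L [R [f [g [h [fgh wL wR]]]]]] := weight_decomp w X.
have [|q fq] := triangle_weak_kernel fgh (p := idm X).
  by rewrite compmI; exact: X0.
by apply: wle_retract wL; exists q, f.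
Qed.

Lemma weight_orth_shift n X Y :
  shift_class (wle w) n X -> shift_class (wge w) (n + 1) Y -> hom_zero X Y.
Proof.
move=> /(shift_classP _ _ wleR) wX wY.
apply: (@hom_zero_shiftn _ (- n)) => f; apply: (weight_orth wX).
by apply: (shift_class_shiftn wgeR _ wY); rewrite addKr.
Qed.

Lemma wle_shift_of_hom_zero n X :
  (forall Y, shift_class (wge w) (n + 1) Y -> hom_zero X Y) ->
  shift_class (wle w) n X.
Proof.
move=> X0; apply/(shift_classP _ _ wleR)/wle_of_hom_zero => Y wY.
apply: (@hom_zero_shiftn _ n).
apply: hom_zero_retract (X0 (shiftn n Y) _).
- exact/isomorphic_retract/shiftnVK.
- exact/isomorphic_retract/isomorphic_refl.
- by apply: (shift_class_shiftn wgeR _ wY).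
Qed.

Lemma wge_anti m n : m <= n -> shift_class (wge w) n `<=` shift_class (wge w) m.
Proof.
move=> mn Y /(shift_classP _ _ wgeR) wY; apply/(shift_classP _ _ wgeR).
have {mn}[k nE] : exists k : nat, n = k%:Z + m.
  by exists `|n - m|%N; rewrite gez0_abs ?subr_ge0// subrK.
have : wge w (shiftn k (shiftn (- n) Y)).
  elim: k {nE} => //= k IH; apply: wge_shift; exists (shiftn k (shiftn (- n) Y)) => //.
  exact: isomorphic_refl.
apply: wge_retract; apply/isomorphic_retract/isomorphic_sym/shiftnDeq.
by rewrite nE opprD addNKr.
Qed.

(** R is an extension of L[1] by N, and both are left orthogonal to the objects
    of weight > n: N by assumption, L[1] because its weight is at most 1 <= n. *)
Lemma wle_cone n L N R (f : hom L N) (g : hom N R) (h : hom R (shift L)) :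
  1 <= n -> dist f g h -> wle w L -> shift_class (wle w) n N ->
  shift_class (wle w) n R.
Proof.
move=> n1 fgh wL wN; apply: wle_shift_of_hom_zero => Y wY u.
have [|v <-] := triangle_weak_cokernel (proj1 (dist_rot f g h) fgh) (p := u).
  exact: (weight_orth_shift wN wY).
rewrite (_ : v = 0) ?comp0m//; apply: (@weight_orth_shift 1).
  by exists L => //; exact: isomorphic_refl.
by apply: wge_anti wY; rewrite lerD2r.
Qed.

End WeightStructures.

(** * Images under weight-exact functors *)

Section WeightExactFunctors.
Variables (C C' : triangulated).
Variables (w : weight_structure C) (w' : weight_structure C').
Variable (F : exact_functor C C').

(** Commutation with the inverse shift is not part of an exact functor's data;
    it follows from commutation with the shift. *)
Lemma efun_shiftn n X : isomorphic (F (shiftn n X)) (shiftn n (F X)).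
Proof.
have Fshift Y : isomorphic (F (shift Y)) (shift (F Y)) by exact: (nat_isoP (eshift F)).
have Funshift Y : isomorphic (F (unshift Y)) (unshift (F Y)).
  apply: isomorphic_trans (isomorphic_sym (nat_isoP (shiftK C') _)) _.
  apply: (isomorphic_fmap unshift).
  apply: isomorphic_trans (isomorphic_sym (Fshift _)) _.
  exact: (isomorphic_fmap F (nat_isoP (unshiftK C) Y)).
case: n => [k|k]; rewrite /shiftn; last move: k.+1 => {}k.
  elim: k => /= [|k IH]; first exact: isomorphic_refl.
  exact: isomorphic_trans (Fshift _) (isomorphic_fmap shift IH).
elim: k => /= [|k IH]; first exact: isomorphic_refl.
exact: isomorphic_trans (Funshift _) (isomorphic_fmap unshift IH).
Qed.

Lemma image_shift_class (A : set C) (A' : set C') n :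
  F @` A `<=` A' -> F @` shift_class A n `<=` shift_class A' n.
Proof.
move=> FA _ [X [X0 AX0 XX0] <-]; exists (F X0); first by apply: FA; exists X0.
exact: isomorphic_trans (isomorphic_fmap F XX0) (efun_shiftn _ _).
Qed.

Lemma Kar_shiftn (A : set C) k n M : retract_closed A ->
  Kar (F @` shift_class A n) M -> Kar (F @` shift_class A (k + n)) (shiftn k M).
Proof.
move=> AR [_ [X AX <-] MX]; exists (F (shiftn k X)).
  by exists (shiftn k X) => //; exact: shift_class_shiftn AX.
apply: retract_trans (retract_shiftn k MX) _.
exact/isomorphic_retract/isomorphic_sym/efun_shiftn.
Qed.

Lemma Kar_min (A : set C) (A' : set C') :
  retract_closed A' -> F @` A `<=` A' -> Kar (F @` A) `<=` A'.
Proof. by move=> A'R FA M [_ [X AX <-] MX]; apply: A'R MX (FA _ _); exists X. Qed.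

Hypothesis Fw : weight_exact w w' F.
Hypothesis Fsurj : essentially_surjective F.

Let wleR : retract_closed (wle w). Proof. exact: wle_retract. Qed.
Let wgeR : retract_closed (wge w). Proof. exact: wge_retract. Qed.
Let wleR' : retract_closed (wle w'). Proof. exact: wle_retract. Qed.
Let wgeR' : retract_closed (wge w'). Proof. exact: wge_retract. Qed.

(** F L -> F N -> M vanishes by orthogonality, so the retraction F N -> M
    extends along F N -> F R. *)
Lemma retract_image_cone (M : C') (L N R : C)
    (f : hom L N) (g : hom N R) (h : hom R (shift L)) :
  dist f g h -> wle w L -> shift_class (wge w') 1 M ->
  is_retract M (F N) -> is_retract M (F R).
Proof.
move=> fgh wL wM [i [p pi]].
have [|q qg] := triangle_weak_cokernel (efun_dist F fgh) (p := p).
  by apply: (weight_orth (w := w') _ wM); apply: Fw.1; exists L.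
by exists (fmap F g ∘ i), q; rewrite compA qg.
Qed.

(** M -> F N -> F R vanishes by orthogonality, so the section M -> F N lifts
    to F L. *)
Lemma retract_image_fiber (M : C') (L N R : C)
    (f : hom L N) (g : hom N R) (h : hom R (shift L)) :
  dist f g h -> shift_class (wge w) 1 R -> wle w' M ->
  is_retract M (F N) -> is_retract M (F L).
Proof.
move=> fgh wR wM [i [p pi]].
have [|q fq] := triangle_weak_kernel (efun_dist F fgh) (p := i).
  apply: (weight_orth wM); apply: (image_shift_class Fw.2); by exists R.
by exists q, (p ∘ fmap F f); rewrite -compA fq.
Qed.

Lemma wle_Kar : wle w' = Kar (F @` wle w).
Proof.
apply/seteqP; split=> [M wM|]; last exact: Kar_min wleR' Fw.1.
have [N FN] := Fsurj M.
have [L [R [f [g [h [fgh wL wR]]]]]] := weight_decomp w N.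
exists (F L); first by exists L.
by apply: retract_image_fiber fgh wR wM _; exact/isomorphic_retract/isomorphic_sym.
Qed.

Lemma wge_Kar : wge w' = Kar (F @` wge w).
Proof.
apply/seteqP; split=> [M wM|]; last exact: Kar_min wgeR' Fw.2.
(* The cone R of a decomposition is of weight >= 1, so one decomposes a lift of
   M[1] and shifts back. *)
have [N FN] := Fsurj (shift M).
have [L [R [f [g [h [fgh wL wR]]]]]] := weight_decomp w N.
have : Kar (F @` shift_class (wge w) 1) (shift M).
  exists (F R); first by exists R.
  apply: (retract_image_cone fgh wL); last exact/isomorphic_retract/isomorphic_sym.
  by exists M => //; exact: isomorphic_refl.
move=> /(Kar_shiftn (-1) wgeR)[_ [X wX <-] MX].
have {}MX := retract_trans (isomorphic_retract (isomorphic_sym (shiftnK 1 M))) MX.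
exists (F X) => //; exists X => //.
by move/(shift_classP _ _ wgeR): wX.
Qed.

Lemma wrange_retract (E : triangulated) (v : weight_structure E) m n :
  retract_closed (wrange v m n).
Proof.
move=> Y Z YZ [gZ lZ]; split.
  by apply: shift_class_retract gZ => //; exact: wge_retract.
by apply: shift_class_retract lZ => //; exact: wle_retract.
Qed.

Lemma wrange_shiftn (E : triangulated) (v : weight_structure E) k m n Y :
  wrange v m n Y -> wrange v (k + m) (k + n) (shiftn k Y).
Proof.
move=> [gY lY]; split.
  by apply: (shift_class_shiftn _ _ gY) => //; exact: wge_retract.
by apply: (shift_class_shiftn _ _ lY) => //; exact: wle_retract.
Qed.

(** The lower bound 1 is the one at which the given weight decomposition cuts, so
    no decomposition has to be shifted.  Starting from a lift N that is already
    of weight <= n, as provided by [wle_Kar], is what bounds R from above. *)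
Lemma wrange1_Kar n M : 1 <= n -> wrange w' 1 n M ->
  exists2 X, wrange w 1 n X & is_retract M (F X).
Proof.
move=> n1 [gM lM].
have : Kar (F @` wle w) (shiftn (- n) M).
  by rewrite -wle_Kar; exact/(shift_classP _ _ wleR').
move=> [_ [N0 wN0 <-] MN0].
have MN : is_retract M (F (shiftn n N0)).
  apply: retract_trans (isomorphic_retract (isomorphic_sym (shiftnVK n M))) _.
  apply: retract_trans (retract_shiftn n MN0) _.
  exact/isomorphic_retract/isomorphic_sym/efun_shiftn.
have [L [R [f [g [h [fgh wL wR]]]]]] := weight_decomp w (shiftn n N0).
exists R; last exact: (retract_image_cone fgh wL gM).
split=> //; apply: wle_cone fgh wL _ => //.
by exists N0 => //; exact: isomorphic_refl.
Qed.

Lemma wrange_Kar m n : m <= n -> wrange w' m n = Kar (F @` wrange w m n).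
Proof.
move=> mn; apply/seteqP; split=> [M wM|]; last first.
  apply: Kar_min; first exact: wrange_retract.
  move=> _ [X [gX lX] <-]; split.
    by apply: (image_shift_class Fw.2); exists X.
  by apply: (image_shift_class Fw.1); exists X.
have := wrange_shiftn (1 - m) wM; rewrite subrK => /wrange1_Kar[|X wX MX].
  by rewrite addrAC lerBrDr lerD2l.
exists (F (shiftn (m - 1) X)).
  exists (shiftn (m - 1) X) => //; have := wrange_shiftn (m - 1) wX.
  by rewrite subrK addrA [m - 1 + _]addrC subrKA subrr add0r.
apply: retract_trans; last exact/isomorphic_retract/isomorphic_sym/efun_shiftn.
apply: retract_trans (retract_shiftn (m - 1) MX).
by rewrite -[1 - m]opprB; apply/isomorphic_retract/isomorphic_sym/shiftnVK.
Qed.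

Lemma has_coproducts_image (K : small -> Prop) :
  respects_coproducts K F -> has_coproducts C K -> has_coproducts C' K.
Proof.
move=> FK CK I KI X.
have /dep_choice[N /dep_choice[a aI]] : forall i, exists (N : C), isomorphic (X i) (F N).
  by move=> i; have [N /isomorphic_sym] := Fsurj (X i); exists N.
have [Y [inj injP]] := CK I KI N; exists (F Y), (fun i => fmap F (inj i) ∘ a i).
exact: is_coproduct_iso (FK _ KI _ _ _ injP) aI.
Qed.

(** The summands are retracts of F (N i) with N i of weight >= 0, so their
    coproduct is a retract of F applied to the coproduct of the N i. *)
Lemma wge_closed_under_coproducts (K : small -> Prop) :
  respects_coproducts K F -> has_coproducts C K ->
  closed_under_coproducts K (wge w) -> closed_under_coproducts K (wge w').
Proof.
move=> FK CK wK I KI X Y inj injP wX.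
have /dep_choice[N NP] : forall i, exists N, wge w N /\ is_retract (X i) (F N).
  move=> i; have := wX i; rewrite {1}wge_Kar => -[_ [N wN <-] XN].
  by exists N.
have [T [b bT]] := CK I KI N; apply: (@wge_retract _ w' _ (F T)).
  by apply: coproduct_retract injP (FK _ KI _ _ _ bT) _ => i; exact: (NP i).2.
apply: Fw.2; exists T => //; apply: wK bT _ => // i; exact: (NP i).1.
Qed.

End WeightExactFunctors.

(** * Essentially surjective weight-exact functors *)

Theorem proposition3p1p1 (C C' : triangulated)
    (w : weight_structure C) (w' : weight_structure C')
    (F : exact_functor C C') (Fsurj : essentially_surjective F) :
  [/\
    weight_exact w w' F <->
      wle w' = Kar (F @` wle w) /\ wge w' = Kar (F @` wge w),
    weight_exact w w' F -> forall m n : int, m <= n ->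
      wrange w' m n = Kar (F @` wrange w m n),
    (forall alpha : small, infinite_regular alpha ->
       weight_exact w w' F -> respects_coproducts (fewer_than alpha) F ->
       alpha_smashing alpha w -> alpha_smashing alpha w') /\
    (weight_exact w w' F -> respects_coproducts all_small F ->
       smashing w -> smashing w') &
    weight_exact w w' F ->
      forall (D : triangulated) (v : weight_structure D) (G : exact_functor C' D),
        weight_exact w v (exact_comp G F) -> weight_exact w' v G].
Proof.
split.
- split=> [Fw|[wleE wgeE]].
    by split; [exact: wle_Kar|exact: wge_Kar].
  by rewrite /weight_exact wleE wgeE; split; exact: sub_Kar.
- by move=> Fw m n; exact: wrange_Kar.
- split=> [alpha _|] Fw FK [CK wK]; (split; first exact: has_coproducts_image FK CK);
    exact: wge_closed_under_coproducts FK CK wK.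
- move=> Fw D v G [GFle GFge]; rewrite /weight_exact (wle_Kar Fw)// (wge_Kar Fw)//.
  split=> _ [M [_ [X wX <-] MX] <-].
    by apply: wle_retract (retract_fmap G MX) (GFle _ _); exists X.
  by apply: wge_retract (retract_fmap G MX) (GFge _ _); exists X.
Qed.
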